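(* Let $z=x+\mathrm{i}y\in\mathbb{C}$ (with $x,y\in\mathbb{R}$) with $x<0$. Then $$\left|\mathcal{C}_1(z)\right|<1 .$$
   Context: $\varphi_1$ is the entire function $\varphi_1(z)=\sum_{k=0}^{+\infty}\frac{z^k}{(k+1)!}=\int_0^1 e^{(1-\xi)z}\,d\xi$ (equal to $(e^z-1)/z$ for $z\ne 0$). Define $$\mathcal{C}_1(z):=1-\frac{\varphi_1(2z)}{\varphi_1(z)}.$$ *)

(* Defs.v *)
From Stdlib Require Import Reals Lra Lia Factorial.
From Coquelicot Require Import Coquelicot.

Open Scope C_scope.

Definition phi1_term (z : C) (k : nat) : C := z ^ k / INR (fact (k + 1)).

(* [iota] picks the unique limit in the complete module C over C, in the same
   way as Coquelicot defines [RInt]; [phi1_correct] shows that the series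
   converges for every [z]. *)
Definition phi1 (z : C) : C :=
  iota (is_series (K := C_AbsRing) (V := C_CompleteNormedModule) (phi1_term z)).

Lemma phi1_correct (z : C) :
  is_series (K := C_AbsRing) (V := C_CompleteNormedModule) (phi1_term z) (phi1 z).
Proof.
assert (Hex : ex_series (K := C_AbsRing) (V := C_CompleteNormedModule) (phi1_term z)).
{ apply ex_series_le with (b := fun k => (/ INR (fact k) * Cmod z ^ k)%R).
  - intros k. change (Cmod (phi1_term z k) <= / INR (fact k) * Cmod z ^ k)%R.
    unfold phi1_term.
    assert (Hk := INR_fact_lt_0 k). assert (Hk1 := INR_fact_lt_0 (k + 1)).
    rewrite Cmod_div by (intros H; apply RtoC_inj in H; lra).
    rewrite Cmod_pow, Cmod_R, Rabs_right by lra.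
    unfold Rdiv. rewrite Rmult_comm. apply Rmult_le_compat_r.
    + apply pow_le, Cmod_ge_0.
    + apply Rinv_le_contravar; [exact Hk|]. apply le_INR, fact_le. lia.
  - exists (exp (Cmod z)).
    eapply is_series_ext; [|apply (is_exp_Reals (Cmod z))].
    intros n. simpl. rewrite pow_n_pow. apply Rmult_comm. }
destruct Hex as [l Hl].
assert (E : phi1 z = l) by exact (iota_filterlim_locally _ l Hl).
rewrite E. exact Hl.
Qed.

(* Coquelicot's total division has [/ 0 = 0], so the value of [calC1] at a zero of
   [phi1] would be [1]. *)
Definition calC1 (z : C) : C := 1 - phi1 (2 * z) / phi1 z.

(* Main.v *)
Require Import Defs.
From Stdlib Require Import Reals Lra Factorial.
From Coquelicot Require Import Coquelicot.

(** For [z <> 0] the function [phi1] is [(e^z - 1) / z], and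
    [e^(2z) - 1 = (e^z - 1) (e^z + 1)], so the quotient [phi1 (2z) / phi1 z] is
    [(e^z + 1) / 2] and [calC1 z = (1 - e^z) / 2].  When [Re z < 0] we have
    [|e^z| = e^(Re z) < 1], hence [|calC1 z| <= (1 + e^(Re z)) / 2 < 1]; the same
    bound gives [e^z <> 1], so that [phi1 z] does not vanish.

    What has to be built is the link between the complex series defining [phi1]
    and the real functions [exp], [cos], [sin] ([phi1_closed_form]).  Multiplying
    the series by [z] and adding [1] gives [1 + z phi1 z] as the sum of
    [z^k / k!].  With [z = x + i y], for real [t], the real and imaginary parts [u t] and [v t] of the
    sum at [t z] are real power series in [t] with infinite radius of convergence,
    and termwise differentiation yields the linear system
    [u' = x u - y v], [v' = y u + x v] with [u 0 = 1], [v 0 = 0].  This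
    system determines [(u 1, v 1) = (exp x cos y, exp x sin y)]
    ([linear_system_at_1]), and the sum at [t = 1] is [1 + z phi1 z]. *)

Open Scope R_scope.

Definition Cexp (z : C) : C :=
  (exp (Re z) * cos (Im z), exp (Re z) * sin (Im z)).

Definition exp_term (z : C) (k : nat) : C := (z ^ k / INR (fact k))%C.

Lemma fact_neq_0_C (k : nat) : RtoC (INR (fact k)) <> RtoC 0.
Proof. intros H; apply RtoC_inj in H; exact (INR_fact_neq_0 k H). Qed.

Lemma Re_div_INR_fact (z : C) (k : nat) :
  Re (z / INR (fact k))%C = Re z / INR (fact k).
Proof.
unfold Cdiv. rewrite <- RtoC_inv, re_scal_r by apply INR_fact_neq_0. reflexivity.
Qed.

Lemma Im_div_INR_fact (z : C) (k : nat) :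
  Im (z / INR (fact k))%C = Im z / INR (fact k).
Proof.
unfold Cdiv. rewrite <- RtoC_inv, im_scal_r by apply INR_fact_neq_0. reflexivity.
Qed.

Lemma is_series_exp_term (z : C) :
  is_series (K := C_AbsRing) (V := C_CompleteNormedModule)
    (exp_term z) (1 + z * phi1 z)%C.
Proof.
apply (is_series_decr_1 (K := C_AbsRing) (V := C_CompleteNormedModule)).
match goal with |- is_series _ ?l => replace l with (scal z (phi1 z)) end.
2: { change ((z * phi1 z = 1 + z * phi1 z + - (1 / 1))%C). field. }
apply (is_series_ext (K := C_AbsRing) (V := C_CompleteNormedModule)
         (fun k => scal z (phi1_term z k))).
- intros k. change ((z * (z ^ k / INR (fact (k + 1))) = z ^ S k / INR (fact (S k)))%C).
  replace (k + 1)%nat with (S k) by (rewrite Nat.add_1_r; reflexivity).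
  rewrite Cpow_S. field. apply fact_neq_0_C.
- apply (is_series_scal (K := C_AbsRing) (V := C_CompleteNormedModule)), phi1_correct.
Qed.

Lemma is_series_Re (a : nat -> C) (l : C) :
  is_series (K := C_AbsRing) (V := C_CompleteNormedModule) a l ->
  is_series (fun k => Re (a k)) (Re l).
Proof.
intros H.
apply (filterlim_ext (fun n => Re (sum_n a n))).
- induction x as [|n IH].
  + rewrite !sum_O. reflexivity.
  + rewrite !sum_Sn, <- IH. reflexivity.
- apply (filterlim_comp _ _ _ _ _ _ _ _ H).
  apply filterlim_locally. intros eps. exists eps. intros w [Hw _]. exact Hw.
Qed.

Lemma is_series_Im (a : nat -> C) (l : C) :
  is_series (K := C_AbsRing) (V := C_CompleteNormedModule) a l ->
  is_series (fun k => Im (a k)) (Im l).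
Proof.
intros H.
apply (filterlim_ext (fun n => Im (sum_n a n))).
- induction x as [|n IH].
  + rewrite !sum_O. reflexivity.
  + rewrite !sum_Sn, <- IH. reflexivity.
- apply (filterlim_comp _ _ _ _ _ _ _ _ H).
  apply filterlim_locally. intros eps. exists eps. intros w [_ Hw]. exact Hw.
Qed.

(** A power series converging at every real point has terms tending to [0] there,
    which is impossible outside a finite disk of convergence. *)
Lemma CV_radius_infinite (a : nat -> R) :
  (forall t, ex_series (fun k => a k * t ^ k)) -> CV_radius a = p_infty.
Proof.
intros H.
destruct (Rbar_lt_le_dec (CV_radius a) p_infty) as [Hlt|Hle].
2: destruct (CV_radius a); [contradiction|reflexivity|contradiction].
exfalso.
pose proof (CV_radius_ge_0 a) as H0.
destruct (CV_radius a) as [r| |] eqn:E; try contradiction.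
apply (CV_disk_outside a (r + 1)).
- rewrite E. simpl in *. rewrite Rabs_right; lra.
- apply ex_series_lim_0, H.
Qed.

Lemma exp_term_scal (z : C) (t : R) (k : nat) :
  exp_term (t * z)%C k = (exp_term z k * RtoC (t ^ k))%C.
Proof.
unfold exp_term. rewrite Cpow_mult_l, RtoC_pow. field. apply fact_neq_0_C.
Qed.

Lemma is_series_Re_exp_term (z : C) (t : R) :
  is_series (fun k => Re (exp_term z k) * t ^ k) (Re (1 + t * z * phi1 (t * z))%C).
Proof.
apply (is_series_ext (fun k => Re (exp_term (t * z)%C k))).
- intros k. rewrite exp_term_scal, re_scal_r. reflexivity.
- apply is_series_Re, is_series_exp_term.
Qed.

Lemma is_series_Im_exp_term (z : C) (t : R) :
  is_series (fun k => Im (exp_term z k) * t ^ k) (Im (1 + t * z * phi1 (t * z))%C).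
Proof.
apply (is_series_ext (fun k => Im (exp_term (t * z)%C k))).
- intros k. rewrite exp_term_scal, im_scal_r. reflexivity.
- apply is_series_Im, is_series_exp_term.
Qed.

(** The coefficients satisfy [(k + 1) c (k + 1) = z c k]: the power series
    reproduces itself, up to the factor [z], under termwise differentiation. *)
Lemma exp_term_S (z : C) (k : nat) :
  (RtoC (INR (S k)) * exp_term z (S k) = z * exp_term z k)%C.
Proof.
unfold exp_term. rewrite fact_simpl, mult_INR, RtoC_mult, Cpow_S. field.
split; [apply fact_neq_0_C|].
intros H; apply RtoC_inj in H. exact (not_0_INR (S k) (Nat.neq_succ_0 k) H).
Qed.

(** Power series in a real variable [t] for the two parts of [e^(t z)]; keeping
    [t] real makes the one-variable theory of differentiation applicable. *)
Definition exp_re (z : C) (t : R) : R := PSeries (fun k => Re (exp_term z k)) t.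
Definition exp_im (z : C) (t : R) : R := PSeries (fun k => Im (exp_term z k)) t.

Lemma ex_pseries_Re_exp_term (z : C) (t : R) :
  ex_pseries (fun k => Re (exp_term z k)) t.
Proof. apply ex_pseries_R. eexists. apply is_series_Re_exp_term. Qed.

Lemma ex_pseries_Im_exp_term (z : C) (t : R) :
  ex_pseries (fun k => Im (exp_term z k)) t.
Proof. apply ex_pseries_R. eexists. apply is_series_Im_exp_term. Qed.

Lemma is_derive_exp_re (z : C) (t : R) :
  is_derive (exp_re z) t (Re z * exp_re z t - Im z * exp_im z t).
Proof.
unfold exp_re, exp_im.
rewrite <- !PSeries_scal, <- PSeries_minus.
2, 3: apply ex_pseries_scal; [apply Rmult_comm|].
2: apply ex_pseries_Re_exp_term.
2: apply ex_pseries_Im_exp_term.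
rewrite <- (PSeries_ext (PS_derive (fun k => Re (exp_term z k)))).
- apply is_derive_PSeries. rewrite CV_radius_infinite; [exact I|].
  intros s. eexists. apply is_series_Re_exp_term.
- intros k. unfold PS_derive. rewrite <- re_scal_l, exp_term_S, re_mult. reflexivity.
Qed.

Lemma is_derive_exp_im (z : C) (t : R) :
  is_derive (exp_im z) t (Im z * exp_re z t + Re z * exp_im z t).
Proof.
unfold exp_re, exp_im.
rewrite <- !PSeries_scal, <- PSeries_plus.
2, 3: apply ex_pseries_scal; [apply Rmult_comm|].
2: apply ex_pseries_Re_exp_term.
2: apply ex_pseries_Im_exp_term.
rewrite <- (PSeries_ext (PS_derive (fun k => Im (exp_term z k)))).
- apply is_derive_PSeries. rewrite CV_radius_infinite; [exact I|].
  intros s. eexists. apply is_series_Im_exp_term.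
- intros k. unfold PS_derive. rewrite <- im_scal_l, exp_term_S, im_mult.
  apply Rplus_comm.
Qed.

(** Written with [f = u + i v], the system is [f' = (x + i y) f], so
    [e^(-t (x + i y)) f t] is constant.  Its real and imaginary parts are the
    functions [p] and [q] of the proof. *)
Lemma linear_system_at_1 (x y : R) (u v : R -> R) :
  (forall t, is_derive u t (x * u t - y * v t)) ->
  (forall t, is_derive v t (y * u t + x * v t)) ->
  u 0 = 1 -> v 0 = 0 ->
  u 1 = exp x * cos y /\ v 1 = exp x * sin y.
Proof.
intros Hu Hv Hu0 Hv0.
assert (Du : forall t : R, Derive (fun s : R => u s) t = x * u t - y * v t)
  by (intros t; apply is_derive_unique, Hu).
assert (Dv : forall t : R, Derive (fun s : R => v s) t = y * u t + x * v t)
  by (intros t; apply is_derive_unique, Hv).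
pose (p := fun t => exp (- (t * x)) * (u t * cos (t * y) + v t * sin (t * y))).
pose (q := fun t => exp (- (t * x)) * (v t * cos (t * y) - u t * sin (t * y))).
assert (Hp : p 0 = p 1).
{ apply eq_is_derive; [|lra]. intros t _. unfold p.
  auto_derive.
  - repeat split; eexists; eauto.
  - rewrite Du, Dv. unfold zero; simpl; ring. }
assert (Hq : q 0 = q 1).
{ apply eq_is_derive; [|lra]. intros t _. unfold q.
  auto_derive.
  - repeat split; eexists; eauto.
  - rewrite Du, Dv. unfold zero; simpl; ring. }
unfold p, q in Hp, Hq.
rewrite !Rmult_0_l, !Rmult_1_l, Ropp_0, exp_0, cos_0, sin_0, Hu0, Hv0 in Hp, Hq.
assert (Hexp : exp x * exp (- x) = 1) by (rewrite <- exp_plus, Rplus_opp_r; apply exp_0).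
assert (Htrig : sin y * sin y + cos y * cos y = 1) by apply sin2_cos2.
assert (Hp1 : u 1 * cos y + v 1 * sin y = exp x).
{ replace (u 1 * cos y + v 1 * sin y) with
    (exp x * exp (- x) * (u 1 * cos y + v 1 * sin y)) by (rewrite Hexp; ring).
  rewrite Rmult_assoc, <- Hp. ring. }
assert (Hq1 : v 1 * cos y - u 1 * sin y = 0).
{ replace (v 1 * cos y - u 1 * sin y) with
    (exp x * exp (- x) * (v 1 * cos y - u 1 * sin y)) by (rewrite Hexp; ring).
  rewrite Rmult_assoc, <- Hq. ring. }
(* [Hp1] and [Hq1] give [u 1 + i v 1] turned by [-y]: rotate back. *)
split.
- replace (u 1) with
    ((u 1 * cos y + v 1 * sin y) * cos y - (v 1 * cos y - u 1 * sin y) * sin y)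
    by (rewrite <- (Rmult_1_r (u 1)) at 3; rewrite <- Htrig; ring).
  rewrite Hp1, Hq1. ring.
- replace (v 1) with
    ((u 1 * cos y + v 1 * sin y) * sin y + (v 1 * cos y - u 1 * sin y) * cos y)
    by (rewrite <- (Rmult_1_r (v 1)) at 3; rewrite <- Htrig; ring).
  rewrite Hp1, Hq1. ring.
Qed.

Lemma phi1_closed_form (z : C) : (1 + z * phi1 z = Cexp z)%C.
Proof.
destruct (linear_system_at_1 (Re z) (Im z) (exp_re z) (exp_im z)) as [Hre Him].
- apply is_derive_exp_re.
- apply is_derive_exp_im.
- unfold exp_re. rewrite PSeries_0. unfold exp_term. rewrite Re_div_INR_fact. simpl. field.
- unfold exp_im. rewrite PSeries_0. unfold exp_term. rewrite Im_div_INR_fact. simpl. field.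
- pose proof (is_series_unique _ _ (is_series_Re_exp_term z 1)) as Sre.
  pose proof (is_series_unique _ _ (is_series_Im_exp_term z 1)) as Sim.
  rewrite !Cmult_1_l in Sre, Sim.
  apply injective_projections; simpl fst; simpl snd; [rewrite <- Hre|rewrite <- Him];
    symmetry; assumption.
Qed.

Lemma Cexp_double (z : C) : Cexp (2 * z)%C = (Cexp z * Cexp z)%C.
Proof.
unfold Cexp.
rewrite re_scal_l, im_scal_l, cos_2a, sin_2a, <- Rplus_diag, exp_plus.
apply injective_projections; simpl; ring.
Qed.

Lemma Cmod_Cexp (z : C) : Cmod (Cexp z) = exp (Re z).
Proof.
unfold Cmod, Cexp; simpl.
replace (_ + _) with (Rsqr (exp (Re z)) * (Rsqr (sin (Im z)) + Rsqr (cos (Im z))))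
  by (unfold Rsqr; ring).
rewrite sin2_cos2, Rmult_1_r. apply sqrt_Rsqr, Rlt_le, exp_pos.
Qed.

Lemma calC1_closed_form (z : C) :
  Cexp z <> RtoC 1 -> calC1 z = ((1 - Cexp z) / 2)%C.
Proof.
intros Hz.
assert (E1 := phi1_closed_form z).
assert (E2 := phi1_closed_form (2 * z)%C).
assert (Hprod : (z * phi1 z <> 0)%C).
{ intros H. rewrite H, Cplus_0_r in E1. congruence. }
assert (Hz0 : z <> RtoC 0) by (intros ->; apply Hprod; ring).
assert (Hphi : phi1 z <> RtoC 0) by (intros H; apply Hprod; rewrite H; ring).
assert (H2 : RtoC 2 <> RtoC 0) by (intros H; apply RtoC_inj in H; lra).
assert (E : phi1 (2 * z)%C = ((Cexp z * Cexp z - 1) / (2 * z))%C).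
{ rewrite <- Cexp_double, <- E2. field. auto. }
unfold calC1. rewrite E, <- E1. field. auto.
Qed.

Theorem theorem3p3 (x y : R) (hx : (x < 0)%R) :
  (Cmod (calC1 (RtoC x + Ci * RtoC y)%C) < 1)%R.
Proof.
set (z := (RtoC x + Ci * RtoC y)%C).
assert (Hre : Re z = x) by (unfold z; simpl; ring).
assert (Hmod : Cmod (Cexp z) < 1).
{ rewrite Cmod_Cexp, Hre, <- exp_0. apply exp_increasing, hx. }
rewrite calC1_closed_form.
2: { intros H. rewrite H, Cmod_1 in Hmod. lra. }
rewrite Cmod_div by (intros H; apply RtoC_inj in H; lra).
rewrite (Cmod_R 2), Rabs_right by lra.
assert (Htri := Cmod_triangle 1 (- Cexp z)).
rewrite Cmod_opp, Cmod_1 in Htri. unfold Cminus. lra.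
Qed.
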